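(* Let $\Delta$ be a matroid on $[n]=\{1,\ldots,n\}$ and let $v\in[n]$ with $\{v\}\in\Delta$ be a vertex that is not a cone point of $\Delta$. Then, as ideals of $S$, $$J(\Delta)=x_v\,J(\Delta\setminus v)+J(\operatorname{link}_\Delta v).$$
   Context: A matroid on $[n]$ is identified with its simplicial complex $\Delta$ of independent sets: a simplicial complex such that for any $F,G\in\Delta$ with $|F|<|G|$ there is $i\in G\setminus F$ with $F\cup\{i\}\in\Delta$. A vertex $v$ is a cone point of $\Delta$ if $v$ belongs to every facet of $\Delta$. $\Delta\setminus v=\{F\in\Delta : v\notin F\}$ and $\operatorname{link}_\Delta v=\{F\in\Delta : v\notin F,\ F\cup\{v\}\in\Delta\}$. $\Bbbk$ is a field, $S=\Bbbk[x_1,\ldots,x_n]$, and for a simplicial complex $\Delta$ on (a subset of) $[n]$ with set of facets $\mathcal F(\Delta)$, the cover ideal is $J(\Delta)=\bigcap_{F\in\mathcal F(\Delta)}(x_i : i\in F)\subseteq S$ (with the ideal for $F=\emptyset$ being $0$). *)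

(* Defs.v *)
From mathcomp Require Import all_boot all_algebra.
From mathcomp Require Import mpoly.

Set Implicit Arguments.
Unset Strict Implicit.
Unset Printing Implicit Defensive.

Import GRing.Theory.
Local Open Scope ring_scope.

Section Complexes.
Variable T : finType.
Implicit Types (Delta : {set {set T}}) (F G : {set T}) (v : T).

Definition simplicial_complex Delta : Prop :=
  set0 \in Delta /\
  forall F G, G \in Delta -> F \subset G -> F \in Delta.

Definition matroid Delta : Prop :=
  simplicial_complex Delta /\
  forall F G, F \in Delta -> G \in Delta -> (#|F| < #|G|)%N ->
    exists2 i, i \in G :\: F & i |: F \in Delta.

Definition facets Delta : {set {set T}} :=
  [set F | maxset (fun G => G \in Delta) F].

Definition cone_point Delta v : Prop :=
  forall F, F \in facets Delta -> v \in F.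

Definition deletion Delta v : {set {set T}} :=
  [set F in Delta | v \notin F].

Definition link Delta v : {set {set T}} :=
  [set F in Delta | (v \notin F) && (v |: F \in Delta)].

End Complexes.

(* Ideals are represented by their membership predicates, so that equality
   of ideals is pointwise equivalence. *)
Section Ideals.
Variable R : comNzRingType.
Implicit Types I J : R -> Prop.

Definition ideal_gen (T : finType) (A : {set T}) (g : T -> R) : R -> Prop :=
  fun p => exists c : T -> R, p = \sum_(i in A) c i * g i.

Definition ideal_add I J : R -> Prop :=
  fun p => exists a b, [/\ I a, J b & p = a + b].

(* x I = {x q : q in I}, which is already closed under addition. *)
Definition ideal_scale (x : R) I : R -> Prop :=
  fun p => exists2 q, I q & p = x * q.

End Ideals.

Definition cover_ideal (K : fieldType) (n : nat) (Delta : {set {set 'I_n}})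
    : {mpoly K[n]} -> Prop :=
  fun p => forall F, F \in facets Delta ->
    ideal_gen F (fun i => 'X_i : {mpoly K[n]}) p.

(* Main.v *)
(** In a matroid all facets have the same cardinality.  Since [v] is not a cone
point, the facets of the deletion are the facets of [Delta] avoiding [v], while
those of the link are the [F :\ v] for [F] a facet containing [v].  Split
[p] in [J(Delta)] into its terms not divisible by [x_v], which must meet each
facet through [v] outside [v] and so lie in [J(link)], and its terms divisible
by [x_v], which meet each facet avoiding [v] and still do after division by
[x_v].  Conversely [J(link)] is contained in [J(Delta)] because every facet [F]
contains a facet of the link: augment [{v}] from [F] and remove [v]. *)
Require Import Defs.
From mathcomp Require Import all_boot all_algebra.
From mathcomp Require Import mpoly.

Set Implicit Arguments.
Unset Strict Implicit.
Unset Printing Implicit Defensive.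

Import GRing.Theory.
Local Open Scope ring_scope.

Section Facets.
Variable T : finType.
Implicit Types (Delta : {set {set T}}) (F G : {set T}) (v : T).

Lemma facetsP Delta F :
  reflect (F \in Delta /\ forall G, G \in Delta -> F \subset G -> G = F)
          (F \in facets Delta).
Proof. by rewrite inE; apply: maxsetP. Qed.

(** Adding and removing [v] are inverse, inclusion-preserving maps between faces of the link and
    faces through [v]. A face containing [v |: G] passes through [v], so maximality transfers both
    ways. *)
Lemma facet_link Delta v G : simplicial_complex Delta ->
  G \in facets (link Delta v) <-> v \notin G /\ v |: G \in facets Delta.
Proof.
move=> [_ sub]; rewrite inE; split.
  case/maxsetP; rewrite inE => /and3P[GD vG vGD] Gmax; split=> //.
  apply/facetsP; split=> // H HD; rewrite subUset sub1set => /andP[vH GH].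
  rewrite -(setD1K vH); congr (_ |: _); apply: Gmax.
    by rewrite inE setD1K // HD !inE eqxx (sub _ _ HD) ?subsetDl.
  by rewrite subsetD1 GH.
case=> vG /facetsP[vGD vGmax]; apply/maxsetP; split.
  by rewrite inE vG vGD (sub _ _ vGD) ?subsetUr.
move=> H; rewrite inE => /and3P[HD vH vHD] GH.
by rewrite -(setU1K vH) (vGmax _ vHD) ?setU1K // setUS.
Qed.

Variable Delta : {set {set T}}.
Hypothesis matD : matroid Delta.

(** Iterated exchange: each step adds an element of [G] to [F] and lowers the gap [#|G| - #|F|], on
    which the induction runs. When [G] is a facet, [H] is one too by cardinality. *)
Lemma matroid_augment F G :
  F \in Delta -> G \in Delta -> (#|F| <= #|G|)%N ->
  exists2 H, H \in Delta & [/\ F \subset H, H \subset F :|: G & #|H| = #|G|].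
Proof.
move=> FD GD leFG; have [k] := ubnP (#|G| - #|F|)%N.
elim: k F FD leFG => // k IHk F FD leFG ltk.
have [eqFG|ltFG] := eqVneq #|F| #|G|.
  by exists F => //; split=> //; apply: subsetUl.
have {}ltFG : (#|F| < #|G|)%N by rewrite ltn_neqAle ltFG.
case: matD => _ /(_ F G FD GD ltFG)[i /setDP[iG iF] iFD].
have ciF : #|i |: F| = #|F|.+1 by rewrite cardsU1 iF.
case: (IHk _ iFD) => [||H HD [iFH HiFG cH]]; first by rewrite ciF.
  by rewrite ciF subnS -ltnS prednK // subn_gt0.
exists H => //; split=> //; first by apply: subset_trans iFH; apply: subsetUr.
apply: subset_trans HiFG _; rewrite -setUA subUset subxx sub1set.
by rewrite inE iG orbT.
Qed.

Lemma facet_card_max F G : F \in facets Delta -> G \in Delta ->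
  (#|G| <= #|F|)%N.
Proof.
case/facetsP=> FD Fmax GD; rewrite leqNgt; apply/negP=> ltFG.
case: matD => _ /(_ F G FD GD ltFG)[i /setDP[_ iF] iFD].
by move: iF; rewrite -(Fmax _ iFD) ?subsetUr // setU11.
Qed.

Lemma facet_of_card F G : F \in facets Delta -> G \in Delta ->
  #|G| = #|F| -> G \in facets Delta.
Proof.
move=> Ff GD cG; apply/facetsP; split=> // H HD GH.
by apply/esym/eqP; rewrite eqEcard GH cG facet_card_max.
Qed.

(** Some facet [B] avoids [v]. Augmenting a facet [H] of the deletion from [B] gives a facet of
    [Delta] inside [H :|: B], hence still avoiding [v]; maximality of [H] makes it equal to [H]. *)
Lemma facet_deletion v H : ~ cone_point Delta v ->
  H \in facets (deletion Delta v) <-> v \notin H /\ H \in facets Delta.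
Proof.
move=> ncone; split; last first.
  case=> vH /facetsP[HD Hmax]; apply/facetsP; split; first by rewrite inE HD.
  by move=> G; rewrite inE => /andP[GD _]; apply: Hmax.
case/facetsP; rewrite inE => /andP[HD vH] Hmax; split=> //.
have [/exists_inP[B Bf vB] | noB] := boolP [exists B in facets Delta, v \notin B].
  have [BD _] := facetsP _ _ Bf.
  have [G GD [HG GHB cG]] := matroid_augment HD BD (facet_card_max Bf HD).
  suff <- : G = H by apply: facet_of_card Bf GD cG.
  apply: Hmax => //; rewrite inE GD; apply: contra vB => /(subsetP GHB).
  by rewrite inE (negPf vH).
(* Without such a [B], every facet contains [v], so [v] would be a cone point. *)
case: ncone => F Ff; apply: contraR noB => vF.
by apply/exists_inP; exists F.
Qed.

(** The augmented face [H] lies in [[set v] :|: F], so [H :\ v] lies in [F]; having the cardinality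
    of [F], [H] is a facet through [v]. *)
Lemma facet_supset_link v F : [set v] \in Delta -> F \in facets Delta ->
  exists2 G, G \in facets (link Delta v) & G \subset F.
Proof.
move=> vD Ff; have [FD _] := facetsP _ _ Ff.
have [H HD [vH HvF cH]] := matroid_augment vD FD (facet_card_max Ff vD).
exists (H :\ v); last by rewrite subDset.
move: vH; rewrite sub1set => vH; apply/facet_link; first by case: matD.
by rewrite setD11 setD1K //; split; last exact: facet_of_card Ff HD cH.
Qed.

End Facets.

Section IdealGen.
Variables (R : comNzRingType) (T : finType).
Implicit Types (A B : {set T}) (g : T -> R).

Lemma ideal_gen0 A g : ideal_gen A g 0.
Proof. by exists (fun=> 0); rewrite big1 // => i _; rewrite mul0r. Qed.

Lemma ideal_genD A g p q :
  ideal_gen A g p -> ideal_gen A g q -> ideal_gen A g (p + q).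
Proof.
case=> c -> [d ->]; exists (fun i => c i + d i).
by rewrite -big_split; apply: eq_bigr => i _; rewrite mulrDl.
Qed.

Lemma ideal_genM A g a p : ideal_gen A g p -> ideal_gen A g (a * p).
Proof.
case=> c ->; exists (fun i => a * c i).
by rewrite mulr_sumr; apply: eq_bigr => i _; rewrite mulrA.
Qed.

Lemma ideal_gen_generator A g i : i \in A -> ideal_gen A g (g i).
Proof.
move=> iA; exists (fun j => (j == i)%:R).
rewrite (bigD1 i) //= eqxx mul1r big1 ?addr0 // => j /andP[_ /negPf->].
by rewrite mul0r.
Qed.

Lemma ideal_gen_sum A g (I : Type) (r : seq I) (P : pred I) (F : I -> R) :
  (forall i, P i -> ideal_gen A g (F i)) ->
  ideal_gen A g (\sum_(i <- r | P i) F i).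
Proof.
by move=> gF; apply: big_ind => //; [apply: ideal_gen0 | apply: ideal_genD].
Qed.

Lemma ideal_genS A B g p : A \subset B -> ideal_gen A g p -> ideal_gen B g p.
Proof.
move=> AB [c ->]; apply: ideal_gen_sum => i iA.
by apply/ideal_genM/ideal_gen_generator/(subsetP AB).
Qed.

End IdealGen.

Section VariableIdeals.
Variables (R : comNzRingType) (n : nat).
Implicit Types (A : {set 'I_n}) (m : 'X_{1..n}) (p : {mpoly R[n]}).

Lemma mpolyX_subK m i : (0 < m i)%N ->
  'X_i * 'X_[m - U_(i)] = 'X_[m] :> {mpoly R[n]}.
Proof. by move=> mi; rewrite -mpolyXD addmC submK // lep1mP -lt0n. Qed.

Lemma ideal_gen_monomial A m a i : i \in A -> (0 < m i)%N ->
  ideal_gen A (fun i => 'X_i : {mpoly R[n]}) (a *: 'X_[m]).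
Proof.
move=> iA mi; rewrite -(mpolyX_subK mi) mulrC scalerAl.
exact/ideal_genM/ideal_gen_generator.
Qed.

(** Together with [ideal_gen_monomial], this lets membership in an ideal of variables be tested term
    by term. *)
Lemma ideal_gen_msupp A p m :
  ideal_gen A (fun i => 'X_i : {mpoly R[n]}) p -> m \in msupp p ->
  exists2 i, i \in A & (0 < m i)%N.
Proof.
case=> c ->; rewrite mcoeff_msupp => mp; apply/exists_inP.
apply: contraNT mp; rewrite negb_exists_in => /forall_inP mA.
rewrite raddf_sum big1 // => i iA /=.
apply: contraNeq (mA i iA); rewrite -mcoeff_msupp.
(* Every monomial of [c i * 'X_i] is some [m'] shifted by [U_(i)], so its exponent at [i] is
   positive. *)
rewrite (perm_mem (msuppMX _ _)) => /mapP[m' _ ->].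
by rewrite mnmDE mnm1E eqxx.
Qed.

End VariableIdeals.

Theorem lemma1p4 (K : fieldType) (n : nat) (Delta : {set {set 'I_n}})
    (v : 'I_n) (hDelta : matroid Delta) (hv : [set v] \in Delta)
    (hcone : ~ cone_point Delta v) :
  forall p : {mpoly K[n]},
  cover_ideal Delta p <->
  ideal_add (ideal_scale 'X_v (cover_ideal (deletion Delta v)))
            (cover_ideal (link Delta v)) p.
Proof.
move=> p; split=> [Jp | [_ [b [[q Jq ->] Jb ->]]] F Ff].
  pose q := \sum_(m <- msupp p | (0 < m v)%N) p@_m *: 'X_[m - U_(v)].
  pose b := \sum_(m <- msupp p | ~~ (0 < m v)%N) p@_m *: 'X_[m].
  exists ('X_v * q), b; split.
  - exists q => // H /(facet_deletion hDelta _ hcone)[vH Hf].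
    rewrite /q big_seq_cond; apply: ideal_gen_sum => m /andP[mp mv].
    have [i iH mi] := ideal_gen_msupp (Jp H Hf) mp.
    (* Since [v] is not in [H], [i] differs from [v], and division by ['X_v] leaves the exponent at
       [i] unchanged. *)
    apply: (ideal_gen_monomial _ iH); rewrite mnmBE mnm1E.
    by rewrite (negPf (memPnC vH i iH)) subn0.
  - move=> G /(facet_link _ _ (proj1 hDelta))[vG vGf].
    rewrite /b big_seq_cond; apply: ideal_gen_sum => m /andP[mp mv].
    have [i] := ideal_gen_msupp (Jp _ vGf) mp.
    (* The variable found in [v |: G] cannot be [v], whose exponent in [m] is zero. *)
    by case/setU1P=> [->|iG mi]; [rewrite (negPf mv) | apply: ideal_gen_monomial iG mi].
  rewrite {1}[p]mpolyE (bigID (fun m : 'X_{1..n} => (0 < m v)%N)) /=.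
  congr (_ + _); rewrite mulr_sumr; apply: eq_bigr => m mv.
  by rewrite -scalerAr mpolyX_subK.
apply: ideal_genD; last first.
  have [G Gf GF] := facet_supset_link hDelta hv Ff.
  exact: ideal_genS GF (Jb G Gf).
(* For ['X_v * q]: either ['X_v] is itself a generator for [F], or [F] is a facet of the deletion
   and [q] already lies in its ideal. *)
have [vF | vF] := boolP (v \in F).
  by rewrite mulrC; apply/ideal_genM/ideal_gen_generator.
by apply/ideal_genM/Jq/facet_deletion.
Qed.
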